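(* Let $t\ge2$, let $\mathbf{p}_1,\dots,\mathbf{p}_t\in\mathbb{Z}^n$ be linearly independent row vectors with positive entries, let $P\in\mathbb{Z}^{t\times n}$ be the matrix with rows $\mathbf{p}_1,\dots,\mathbf{p}_t$ in that order, let $\mathbf{r}\in\mathbb{Z}^n$ be a row vector, and let $c_n$ be the (fixed) strength of the basis reduction used. For multipliers $M_1>M_2>\dots>M_t$ let $$A=\begin{bmatrix}\mathbf{p}_1M_1+\mathbf{p}_2M_2+\dots+\mathbf{p}_tM_t+\mathbf{r}\\ I\end{bmatrix},$$ where $I$ is the $n\times n$ identity matrix, let $U$ be the $n\times n$ unimodular matrix computed by applying basis reduction of strength $c_n$ to $A$, and let $\tilde P=PU$. There exist functions $f_1,\dots,f_t$ with the following property. Given $\mathbf{s}\in\mathbb{Z}^t$ with entries satisfying $$1\le s_t\le\dots\le s_1\le n-t,$$ if $$M_i>f_i(M_{i+1},\dots,M_t,s_i,P,\mathbf{r},c_n),\qquad i=1,\dots,t,$$ then $$\tilde P_{i,1:s_i}=0,\qquad i=1,\dots,t.$$ Further, there exist $M_i$ with size polynomial in $\mathrm{size}(P)$, $\mathrm{size}(\mathbf{r})$ and $\mathrm{size}(c_n)$ satisfying the inequalities $M_i>f_i(M_{i+1},\dots,M_t,s_i,P,\mathbf{r},c_n)$, $i=1,\dots,t$.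
   Context: $\|\cdot\|$ is the Euclidean norm. For $B\in\mathbb{R}^{m\times n}$ with $m\ge n$ and linearly independent columns, $\mathcal{L}(B)=\{B\mathbf{x}\mid\mathbf{x}\in\mathbb{Z}^n\}$ is the lattice generated by the columns of $B$, and its $k$-th successive minimum is $\Lambda_k(\mathcal{L}(B))=\min\{\tau\mid\text{there exist } k \text{ linearly independent vectors in }\mathcal{L}(B)\text{ with norm at most }\tau\}$. Basis reduction applied to $B$ computes a unimodular $U\in\mathbb{Z}^{n\times n}$; it has strength $c_n$ (a constant depending only on $n$) if the columns $\tilde{\mathbf{b}}_1,\dots,\tilde{\mathbf{b}}_n$ of $\tilde B=BU$ always satisfy $\max\{\|\tilde{\mathbf{b}}_1\|,\dots,\|\tilde{\mathbf{b}}_\ell\|\}\le c_n\Lambda_\ell(\mathcal{L}(B))$ for $\ell=1,\dots,n$. For $1\le r\le s\le n$, $\tilde P_{i,r:s}$ denotes the vector of the $r$-th through $s$-th entries of the $i$-th row of $\tilde P$. The size of a number, vector or matrix is its binary encoding length. The function $f_t$ has no $M$-arguments, i.e. it depends only on $s_t,P,\mathbf{r},c_n$. *)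

(* Defs.v *)
From mathcomp Require Import all_boot all_order all_algebra.
From mathcomp Require Import all_classical all_reals.

Set Implicit Arguments.
Unset Strict Implicit.
Unset Printing Implicit Defensive.

Import Order.TTheory GRing.Theory Num.Theory.
Local Open Scope classical_set_scope.
Local Open Scope ring_scope.

(* The library norm on matrices is the sup norm, hence this definition. *)
Definition enorm (R : realType) (m : nat) (v : 'cV[R]_m) : R :=
  Num.sqrt (\sum_(i < m) v i 0 ^+ 2).

Definition lattice (R : realType) (m n : nat) (B : 'M[R]_(m, n)) :
    set 'cV[R]_m :=
  [set B *m map_mx intr x | x in [set: 'cV[int]_n]].

Definition cols_free (R : realType) (m n : nat) (B : 'M[R]_(m, n)) : bool :=
  row_free B^T.

Definition minima_bounds (R : realType) (m n : nat) (B : 'M[R]_(m, n))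
    (k : nat) : set R :=
  [set tau | exists V : 'M[R]_(m, k),
    [/\ cols_free V,
        forall j, lattice B (col j V) &
        forall j, enorm (col j V) <= tau]].

(* For 1 <= k <= n and B with independent columns the lattice is discrete, so
   this infimum is attained: it is the minimum of [minima_bounds B k], as
   proved in [successive_minimum_attained] below. *)
Definition successive_minimum (R : realType) (m n : nat) (B : 'M[R]_(m, n))
    (k : nat) : R :=
  inf (minima_bounds B k).

(* [br] maps a basis B (with n columns, in any ambient dimension m) to the
   transformation U.  Invertibility of U over [int] means \det U = 1 or -1. *)
Definition basis_reduction_of_strength (R : realType) (n : nat) (c : R)
    (br : forall m : nat, 'M[R]_(m, n) -> 'M[int]_n) : Prop :=
  forall (m : nat) (B : 'M[R]_(m, n)), (n <= m)%N -> cols_free B ->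
    br m B \in unitmx /\
    forall l : nat, (1 <= l <= n)%N ->
      \big[Num.max/0]_(j < n | (j < l)%N)
         enorm (col j (B *m map_mx intr (br m B)))
      <= c * successive_minimum B l.

(* [p_1 M_1 + ... + p_t M_t + r] stacked on top of the identity. *)
Definition knapsack_matrix (R : realType) (t n : nat) (P : 'M[int]_(t, n))
    (r : 'rV[int]_n) (M : t.-tuple R) : 'M[R]_(1 + n, n) :=
  col_mx (\sum_(i < t) tnth M i *: map_mx intr (row i P) + map_mx intr r) 1%:M.

(* Binary encoding lengths.  One sign bit and [ceil (log_2 (|z| + 1))] digits
   for an integer; numerator and denominator for a rational; for a matrix, one
   unit per entry in addition to the entries, so that the dimensions count. *)
Definition size_int (z : int) : nat := (1 + up_log 2 `|z|.+1)%N.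

Definition size_rat (q : rat) : nat := (size_int (numq q) + size_int (denq q))%N.

Definition size_mx (m n : nat) (A : 'M[int]_(m, n)) : nat :=
  (m * n + \sum_(i < m) \sum_(j < n) size_int (A i j))%N.

Lemma col_lattice_vector (R : realType) (m n k : nat) (B : 'M[R]_(m, n))
    (X : 'M[int]_(n, k)) j :
  B *m map_mx intr (col j X) = col j (B *m map_mx intr X).
Proof.
by apply/matrixP => i l; rewrite !mxE; apply: eq_bigr => h _; rewrite !mxE.
Qed.

Lemma minima_bounds_nonempty (R : realType) (m n : nat) (B : 'M[R]_(m, n))
    (k : nat) : cols_free B -> (1 <= k <= n)%N -> exists tau, minima_bounds B k tau.
Proof.
move=> fB /andP[_ kn].
pose E : 'M[int]_(n, k) := \matrix_(i, j) (val i == val j)%:R.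
exists (\sum_(j < k) enorm (col j (B *m map_mx intr E))), (B *m map_mx intr E); split.
- rewrite /cols_free trmx_mul /row_free mxrankMfree //.
  have -> : (map_mx intr E : 'M[R]_(n, k))^T = pid_mx k.
    apply/matrixP => i j; rewrite !mxE ltn_ord andbT eq_sym.
    by case: (_ == _).
  by rewrite rank_pid_mx.
- move=> j; exists (col j E) => //.
  exact: col_lattice_vector.
- move=> j; rewrite (bigD1 j) //= lerDl sumr_ge0 // => i _; exact: sqrtr_ge0.
Qed.

Lemma coord_bound (R : realType) (m n : nat) (B : 'M[R]_(m, n)) : cols_free B ->
  exists C : R, forall (x : 'cV[R]_n) i, `|x i 0| <= C * enorm (B *m x).
Proof.
move=> fB; have [G GB] := row_freeP fB.
have {}GB : G^T *m B = 1%:M by rewrite -[B]trmxK -trmx_mul GB trmx1.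
exists (\sum_i \sum_j `|G^T i j|) => x i.
have norm_le (v : 'cV[R]_m) j : `|v j 0| <= enorm v.
  rewrite -sqrtr_sqr ler_sqrt; last by apply: sumr_ge0 => l _; rewrite sqr_ge0.
  by rewrite (bigD1 j) //= lerDl sumr_ge0 // => l _; rewrite sqr_ge0.
rewrite -{1}[x]mul1mx -GB -mulmxA mxE.
apply: le_trans (ler_norm_sum _ _ _) _.
apply: (@le_trans _ _ ((\sum_j `|G^T i j|) * enorm (B *m x))).
  by rewrite mulr_suml ler_sum // => j _; rewrite normrM ler_wpM2l.
rewrite ler_wpM2r ?sqrtr_ge0 // (bigD1 i) //= lerDl.
by apply: sumr_ge0 => l _; apply: sumr_ge0.
Qed.

Lemma successive_minimum_attained (R : realType) (m n : nat)
    (B : 'M[R]_(m, n)) (k : nat) : cols_free B -> (1 <= k <= n)%N ->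
  minima_bounds B k (successive_minimum B k) /\
  forall tau, minima_bounds B k tau -> successive_minimum B k <= tau.
Proof.
move=> fB kn; have [C HC] := coord_bound fB.
have [tau0 t0] := minima_bounds_nonempty fB kn.
have k0 : (0 < k)%N by case/andP: kn.
have ge0 tau : minima_bounds B k tau -> 0 <= tau.
  by case=> V [_ _ /(_ (Ordinal k0))]; apply: le_trans (sqrtr_ge0 _).
have lb : lbound (minima_bounds B k) 0 by move=> tau /ge0.
have hlb : has_lbound (minima_bounds B k) by exists 0.
split; last by move=> tau ht; exact: ge_inf.
(* only finitely many coefficient matrices have columns of norm <= tau0 *)
pose N := `|Num.ceil (`|C| * tau0)|%N.
pose X (F : {ffun 'I_n * 'I_k -> 'I_(N + N).+1}) : 'M[int]_(n, k) :=
  \matrix_(i, j) ((F (i, j))%:Z - N%:Z).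
pose V F : 'M[R]_(m, k) := B *m map_mx intr (X F).
pose val F : R := \big[Num.max/0]_(j < k) enorm (col j (V F)).
have latV F j : lattice B (col j (V F)).
  by exists (col j (X F)) => //; exact: col_lattice_vector.
have valP F j : enorm (col j (V F)) <= val F by exact: le_bigmax.
have key tau : minima_bounds B k tau -> tau <= tau0 ->
    exists2 F, cols_free (V F) & val F <= tau.
  move=> ht tt0; case: (ht) => W [fW lW nW].
  have /choice[x xP] : forall j, exists x : 'cV[int]_n, B *m map_mx intr x = col j W.
    by move=> j; case: (lW j) => x _ <-; exists x.
  have bx j i : `|x j i 0| <= N%:Z.
    rewrite -(ler_int R) intr_norm.
    have := HC (map_mx intr (x j)) i; rewrite mxE xP => /le_trans; apply.
    apply: (@le_trans _ _ (`|C| * tau0)).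
      apply: le_trans (ler_wpM2r (sqrtr_ge0 _) (ler_norm C)) _.
      by rewrite ler_wpM2l // (le_trans (nW j)).
    apply: le_trans (ceil_ge _) _.
    by rewrite ler_int /N abszE ler_norm.
  pose F := [ffun ij : 'I_n * 'I_k => inord (absz (x ij.2 ij.1 0 + N%:Z)) : 'I_(N + N).+1].
  have VE : V F = W.
    have -> : V F = \matrix_(i, j) (col j W) i 0.
      apply/matrixP => i j; rewrite [RHS]mxE -xP !mxE; apply: eq_bigr => l _.
      rewrite !mxE ffunE /=; congr (_ * _%:~R).
      have := bx j l; rewrite ler_norml => /andP[h1 h2].
      have p0 : 0 <= x j l 0 + N%:Z by rewrite -lerBlDr sub0r.
      have e : (absz (x j l 0 + N%:Z))%:Z = x j l 0 + N%:Z by rewrite abszE ger0_norm.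
      rewrite inordK; first by rewrite e addrK.
      by rewrite ltnS -lez_nat e PoszD lerD2r.
    by apply/matrixP => i j; rewrite !mxE.
  exists F; first by rewrite VE.
  by apply: bigmax_le => [|j _]; [exact: ge0 | rewrite VE].
have [F0 fF0 vF0] := key _ t0 (lexx _).
case: (@Order.TotalTheory.arg_minP _ R _ F0 (fun F => cols_free (V F)) val fF0)
  => F fF minF.
have valin : minima_bounds B k (val F).
  by exists (V F); split => // j; exact: valP.
suff -> : successive_minimum B k = val F by [].
apply/le_anti/andP; split; first exact: ge_inf.
apply: lb_le_inf; first by exists tau0.
move=> tau ht; have [tt0|/ltW t0t] := leP tau tau0.
  by have [G fG vG] := key _ ht tt0; exact: le_trans (minF _ fG) vG.
exact: le_trans (minF _ fF0) (le_trans vF0 t0t).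
Qed.

(* Main.v *)
Require Import Defs.
From mathcomp Require Import all_boot all_order all_algebra.
From mathcomp Require Import all_classical all_reals.
From mathcomp Require mpoly.
Import (canonicals, coercions) mpoly.
From mathcomp Require Import perm zify lra.

Set Implicit Arguments.
Unset Strict Implicit.
Unset Printing Implicit Defensive.

Import Order.TTheory GRing.Theory Num.Theory.
Local Open Scope ring_scope.

(** The vectors of the integer kernel of P are cheap for the extended matrix A,
    whatever the multipliers: if P x = 0, the first entry of A x is just r x.
    The kernel has dimension n - t, so Lambda_l (A) with l <= n - t is at most
    a number that depends on P and r only, and the first l reduced columns A u
    have norm at most a constant K depending on P, r and c.  Since A contains
    the identity, the entries of u, and of P u, are then bounded as well,
    again independently of the multipliers.

    Now read off the first entry of A u,
      M_1 (p_1 u) + ... + M_t (p_t u) + r u,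
    which is at most K in absolute value.  If p_1 u, ..., p_(i-1) u vanish and
    M_i exceeds what K and the terms with smaller multipliers can compensate,
    the integer p_i u has absolute value below 1, hence is 0; this gives the
    claim by induction on i ([knapsack_coord_eq0]).  The induction stays inside
    the same column because the s_i are nonincreasing.

    Polynomial size requires an explicit K.  Short kernel vectors come from
    Cramer's rule for the Gram matrix G = P P^T: with d = det G the columns of
      V = d I - P^T adj(G) P
    lie in the kernel, and V has rank at least n - t because d I has rank n
    ([short_kernel_vectors]).  All bounds are made in the entrywise l1 norm,
    which is submultiplicative, dominates the Euclidean norm, and is at most
    2 ^ size for an integer matrix.  So K and the resulting threshold are
    2 ^ E with E polynomial in the sizes ([threshold_exp]), the threshold for
    M_i being 2 ^ E (1 + M_(i+1) + ... + M_t).  The geometric choice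
    M_i = (2 ^ (E + 1)) ^ (t - i + 1), for i = 1, ..., t, meets these
    inequalities and has (E + 1) t + O(1) bits at most. *)

(** * The entrywise l1 norm of a matrix *)

Definition mxl1 (F : numDomainType) (m n : nat) (A : 'M[F]_(m, n)) : F :=
  \sum_i \sum_j `|A i j|.

Lemma mxl1_ge0 (F : numDomainType) m n (A : 'M[F]_(m, n)) : 0 <= mxl1 A.
Proof. by apply: sumr_ge0 => i _; apply: sumr_ge0. Qed.

Lemma row_le_mxl1 (F : numDomainType) m n (A : 'M[F]_(m, n)) i :
  \sum_j `|A i j| <= mxl1 A.
Proof.
rewrite /mxl1 (bigD1 i) //= lerDl.
by apply: sumr_ge0 => k _; apply: sumr_ge0.
Qed.

Lemma entry_le_mxl1 (F : numDomainType) m n (A : 'M[F]_(m, n)) i j :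
  `|A i j| <= mxl1 A.
Proof.
by apply: le_trans (row_le_mxl1 A i); rewrite (bigD1 j) //= lerDl sumr_ge0.
Qed.

Lemma mxl1_tr (F : numDomainType) m n (A : 'M[F]_(m, n)) : mxl1 A^T = mxl1 A.
Proof.
rewrite /mxl1 exchange_big /=; apply: eq_bigr => i _.
by apply: eq_bigr => j _; rewrite mxE.
Qed.

Lemma mxl1_scalar (F : numDomainType) n (a : F) :
  mxl1 (a%:M : 'M_n) = `|a| *+ n.
Proof.
rewrite /mxl1 -[n in RHS]card_ord -sumr_const; apply: eq_bigr => i _.
rewrite (bigD1 i) //= !mxE eqxx mulr1n big1 ?addr0 // => j ji.
by rewrite !mxE eq_sym (negPf ji) mulr0n normr0.
Qed.

Lemma mxl1B (F : numDomainType) m n (A B : 'M[F]_(m, n)) :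
  mxl1 (A - B) <= mxl1 A + mxl1 B.
Proof.
rewrite /mxl1 -big_split /=; apply: ler_sum => i _.
by rewrite -big_split /=; apply: ler_sum => j _; rewrite !mxE ler_normB.
Qed.

Lemma mxl1_col_mx (F : numDomainType) m1 m2 n (A : 'M[F]_(m1, n))
    (B : 'M[F]_(m2, n)) : mxl1 (col_mx A B) = mxl1 A + mxl1 B.
Proof.
rewrite /mxl1 big_split_ord /=; congr (_ + _).
  by apply: eq_bigr => i _; apply: eq_bigr => j _; rewrite col_mxEu.
by apply: eq_bigr => i _; apply: eq_bigr => j _; rewrite col_mxEd.
Qed.

Lemma mxl1_col (F : numDomainType) m n (A : 'M[F]_(m, n)) j :
  mxl1 (col j A) <= mxl1 A.
Proof.
apply: ler_sum => i _; rewrite big_ord1 mxE.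
by rewrite (bigD1 j) //= lerDl sumr_ge0.
Qed.

Lemma mxl1_map_intr (F : numDomainType) m n (A : 'M[int]_(m, n)) :
  mxl1 (map_mx intr A : 'M[F]_(m, n)) = (mxl1 A)%:~R.
Proof.
rewrite /mxl1 rmorph_sum; apply: eq_bigr => i _; rewrite rmorph_sum.
by apply: eq_bigr => j _; rewrite mxE /= intr_norm.
Qed.

Lemma mxl1M (F : numDomainType) m n p (A : 'M[F]_(m, n)) (B : 'M[F]_(n, p)) :
  mxl1 (A *m B) <= mxl1 A * mxl1 B.
Proof.
rewrite {1 2}/mxl1 mulr_suml; apply: ler_sum => i _.
apply: (@le_trans _ _ (\sum_k \sum_j `|A i j| * `|B j k|)).
  apply: ler_sum => k _; rewrite mxE; apply: le_trans (ler_norm_sum _ _ _) _.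
  by apply: ler_sum => j _; rewrite normrM.
rewrite exchange_big mulr_suml; apply: ler_sum => j _ /=.
by rewrite -mulr_sumr ler_wpM2l // row_le_mxl1.
Qed.

(** Expanding the product of the row sums gives one term for every function
    from rows to columns; the Leibniz formula keeps only the bijective ones. *)
Lemma det_le_prod_row_sums (F : numDomainType) n (A : 'M[F]_n) :
  `|\det A| <= \prod_i \sum_j `|A i j|.
Proof.
rewrite bigA_distr_bigA /=.
apply: (@le_trans _ _ (\sum_(s : 'S_n) \prod_i `|A i (s i)|)).
  apply: le_trans (ler_norm_sum _ _ _) _; apply: ler_sum => s _.
  by rewrite normrM normr_sign mul1r normr_prod.
(* permutations are the injective functions among the index set of the RHS *)
rewrite [leRHS](bigID (fun f : {ffun 'I_n -> 'I_n} => injectiveb f)) /=.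
apply: ler_wpDr.
  by apply: sumr_ge0 => f _; apply: prodr_ge0.
rewrite (reindex (@pval 'I_n)) /=.
  rewrite le_eqVlt; apply/orP; left; apply/eqP; apply: eq_big => [s|s _].
    by rewrite (valP s).
  by apply: eq_bigr => i _; rewrite pvalE.
exists (fun f => insubd (1%g : {perm _}) f) => [s _|f fP]; first exact: valKd.
by apply: insubdK.
Qed.

Lemma det_le_expr (F : numDomainType) n (A : 'M[F]_n) (b : F) :
  mxl1 A <= b -> `|\det A| <= b ^+ n.
Proof.
move=> Ab; apply: le_trans (det_le_prod_row_sums A) _.
rewrite -[n in leRHS]card_ord -prodr_const; apply: ler_prod => i _.
by rewrite sumr_ge0 //= (le_trans (row_le_mxl1 A i)).
Qed.

Lemma mxl1_minor (F : numDomainType) n (A : 'M[F]_n) i j :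
  mxl1 (row' i (col' j A)) <= mxl1 A.
Proof.
case: n A i j => [|n] A i j; first by case: i.
rewrite [leRHS]/mxl1 (bigD1_ord i) //=; apply: ler_wpDl; first exact: sumr_ge0.
apply: ler_sum => k _; rewrite (bigD1_ord j) //=; apply: ler_wpDl => //.
by apply: ler_sum => l _; rewrite !mxE.
Qed.

(** Each of the n * n cofactors is a determinant of order n - 1; as 1 <= b the
    exponent may be raised to n, which spares the predecessor. *)
Lemma mxl1_adj (F : numDomainType) n (A : 'M[F]_n) (b : F) :
  1 <= b -> mxl1 A <= b -> mxl1 (\adj A) <= b ^+ n *+ (n * n).
Proof.
move=> b1 Ab; rewrite /mxl1 mulrnA -[X in _ *+ X]card_ord -sumr_const.
apply: ler_sum => i _; rewrite -[n in leRHS]card_ord -sumr_const.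
apply: ler_sum => j _; rewrite mxE /cofactor normrM normrX normrN1 expr1n mul1r.
apply: le_trans (det_le_expr (le_trans (mxl1_minor A j i) Ab)) _.
by rewrite card_ord ler_weXn2l // leq_pred.
Qed.

(** * Sizes bound absolute values *)

(** The summand 1 is what makes the bound pass through sums: the product
    (x + 1) (y + 1) dominates x + y + 1, while x <= 2 ^ e and y <= 2 ^ f alone
    would not give x + y <= 2 ^ (e + f). *)
Lemma sum_add1_exp2 (I : Type) (s : seq I) (x : I -> int) (e : I -> nat) :
  (forall i, 0 <= x i) -> (forall i, x i + 1 <= 2 ^+ e i) ->
  \sum_(i <- s) x i + 1 <= 2 ^+ (\sum_(i <- s) e i)%N.
Proof.
move=> x0 xe; suff [] : 0 <= \sum_(i <- s) x i /\
  \sum_(i <- s) x i + 1 <= 2 ^+ (\sum_(i <- s) e i)%N by [].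
elim/big_ind2: _ => [||i _]; [by [] | | by split].
move=> x1 e1 x2 e2 [x10 h1] [x20 h2]; split; first exact: addr_ge0.
apply: (@le_trans _ _ ((x1 + 1) * (x2 + 1))); first by nia.
by rewrite exprD; apply: ler_pM => //; lia.
Qed.

Lemma size_int_exp2 (z : int) : `|z| + 1 <= 2 ^+ size_int z.
Proof.
have h : (`|z|.+1 <= 2 ^ up_log 2 `|z|.+1)%N by exact: up_logP.
rewrite -abszE /size_int exprS -[2 ^+ _]/((2%:R : int) ^+ _) -natrX natz.
by move: h; lia.
Qed.

Lemma mxl1_exp2 m n (A : 'M[int]_(m, n)) : mxl1 A <= 2 ^+ size_mx A.
Proof.
have h : mxl1 A + 1 <= 2 ^+ (\sum_(i < m) \sum_(j < n) size_int (A i j))%N.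
  apply: sum_add1_exp2 => i; first exact: sumr_ge0.
  by apply: sum_add1_exp2 => // j; exact: size_int_exp2.
apply: le_trans (_ : mxl1 A + 1 <= _); first by rewrite lerDl.
by apply: le_trans h _; rewrite ler_weXn2l // leq_addl.
Qed.

Lemma ratr_exp2 (R : realFieldType) (c : rat) :
  `|ratr c : R| <= 2 ^+ size_rat c.
Proof.
rewrite /ratr normrM normfV -!intr_norm.
apply: (@le_trans _ _ (`|numq c|%:~R)).
  rewrite ler_piMr ?ler0z // invf_le1 ?ltr0z ?normr_gt0 ?denq_neq0 //.
  by rewrite ler1z -gtz0_ge1 normr_gt0 denq_neq0.
apply: (@le_trans _ _ ((2 ^+ size_int (numq c) : int)%:~R)).
  by rewrite ler_int (le_trans _ (size_int_exp2 _)) // lerDl.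
by rewrite rmorphXn /= ler_weXn2l ?ler1n // leq_addr.
Qed.

(** * Short integer vectors in the kernel *)

(** If v G = 0 then 0 = v P P^T v^T is the squared length of v P, so v P = 0. *)
Lemma gram_det_neq0 (R : realFieldType) t n (P : 'M[R]_(t, n)) :
  row_free P -> \det (P *m P^T) != 0.
Proof.
move=> fP; apply/det0P => -[v vN0 vG]; case/eqP: vN0.
apply: (row_free_inj fP); rewrite mul0mx.
have sq : \sum_j (v *m P) 0 j ^+ 2 = 0.
  have := congr1 (fun A : 'rV_t => (A *m v^T) 0 0) vG.
  rewrite /= mulmxA -mulmxA -trmx_mul mul0mx [RHS]mxE.
  move=> h; apply: etrans h; rewrite mxE.
  by apply: eq_bigr => j _; rewrite expr2 [_^T _ _]mxE.
apply/rowP => j; rewrite [RHS]mxE; apply/eqP; rewrite -sqrf_eq0; apply/eqP.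
by apply: (psumr_eq0P _ sq) => // i _; exact: sqr_ge0.
Qed.

(** The vectors are columns of V = d I - P^T adj(G) P for the Gram matrix
    G = P P^T of determinant d.  Using G instead of a nonsingular t x t minor
    of P avoids selecting columns, at the price of squaring the bound b. *)
Lemma short_kernel_vectors (R : realFieldType) t n (P : 'M[int]_(t, n))
    (b : int) (l : nat) :
  row_free (map_mx intr P : 'M[R]_(t, n)) -> 1 <= b -> mxl1 P <= b ->
  (l <= n - t)%N ->
  exists X : 'M[int]_(n, l),
    [/\ P *m X = 0,
        row_free (map_mx intr X : 'M[R]_(n, l))^T &
        forall j, mxl1 (col j X)
          <= b ^+ (2 * t) *+ n + b ^+ 2 * (b ^+ (2 * t) *+ (t * t))].
Proof.
move=> fP b1 Pb ln.
have b0 : 0 <= b by exact: le_trans b1.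
pose G := P *m P^T; pose d := \det G.
pose V : 'M[int]_n := d%:M - P^T *m \adj G *m P.
have PV : P *m V = 0.
  by rewrite mulmxBr !mulmxA -/G mul_mx_adj scalar_mxC subrr.
have Gb : mxl1 G <= b ^+ 2.
  apply: le_trans (mxl1M _ _) _; rewrite mxl1_tr expr2.
  by apply: ler_pM; rewrite ?mxl1_ge0.
have b21 : 1 <= b ^+ 2 by rewrite exprn_ege1.
have Vb : mxl1 V <= b ^+ (2 * t) *+ n + b ^+ 2 * (b ^+ (2 * t) *+ (t * t)).
  apply: le_trans (mxl1B _ _) _; apply: lerD.
    by rewrite mxl1_scalar lerMn2r exprM det_le_expr ?orbT.
  apply: le_trans (mxl1M _ _) _.
  apply: (@le_trans _ _ (mxl1 P^T * mxl1 (\adj G) * mxl1 P)).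
    by rewrite ler_wpM2r ?mxl1_ge0 // mxl1M.
  rewrite mxl1_tr mulrAC expr2; apply: ler_pM.
  - by rewrite mulr_ge0 ?mxl1_ge0.
  - exact: mxl1_ge0.
  - by apply: ler_pM; rewrite ?mxl1_ge0.
  - by rewrite exprM mxl1_adj.
(* d I = V + P^T adj(G) P, and the second term has rank at most t *)
pose W := (map_mx intr V : 'M[R]_n)^T.
have lW : (l <= \rank W)%N.
  apply: leq_trans ln _; rewrite leq_subLR mxrank_tr.
  have dN0 : (d%:~R : R) != 0.
    by rewrite -det_map_mx map_mxM -matrix.map_trmx gram_det_neq0.
  rewrite -[leqLHS](_ : \rank ((d%:~R)%:M : 'M[R]_n) = n); last first.
    by rewrite mxrank_unit // unitmxE det_scalar unitrX // unitfE.
  rewrite -map_scalar_mx /= -[X in map_mx _ X](subrK (P^T *m \adj G *m P)).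
  rewrite -/V map_mxD addnC (leq_trans (mxrank_add _ _)) // leq_add2l.
  by rewrite map_mxM (leq_trans (mxrankM_maxr _ _)) // rank_leq_row.
pose g := maxrankfun W \o widen_ord lW.
exists (mxsub id g V); split.
- by rewrite mulmx_colsub PV; apply/matrixP => i j; rewrite !mxE.
- have -> : (map_mx intr (mxsub id g V) : 'M[R]_(n, l))^T
     = pid_mx l *m mxsub (maxrankfun W) id W.
    by rewrite pid_mxErow -rowsubE; apply/matrixP => i j; rewrite !mxE.
  by rewrite /row_free mxrankMfree ?maxrowsub_free // rank_pid_mx.
- move=> j; rewrite col_mxsub; apply: le_trans Vb.
  apply: le_trans (mxl1_col V (g j)); apply: ler_sum => i _.
  by rewrite !big_ord1 !mxE.
Qed.

(** * Successive minima and reduced columns *)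

Lemma enorm_le_mxl1 (R : realType) m (v : 'cV[R]_m) : enorm v <= mxl1 v.
Proof.
rewrite -[leRHS]ger0_norm ?mxl1_ge0 // -sqrtr_sqr /enorm ler_wsqrtr //.
rewrite expr2 [X in _ <= X * _]/mxl1 mulr_suml; apply: ler_sum => i _.
by rewrite big_ord1 -real_normK ?num_real // expr2 ler_wpM2l // entry_le_mxl1.
Qed.

Lemma entry_le_enorm (R : realType) m (v : 'cV[R]_m) i : `|v i 0| <= enorm v.
Proof.
rewrite -sqrtr_sqr ler_wsqrtr // (bigD1 i) //= lerDl.
by apply: sumr_ge0 => k _; rewrite sqr_ge0.
Qed.

Lemma successive_minimum_le (R : realType) m n l (B : 'M[R]_(m, n))
    (X : 'M[int]_(n, l)) (tau : R) :
  cols_free B -> (1 <= l <= n)%N -> row_free (map_mx intr X : 'M[R]_(n, l))^T ->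
  (forall j, enorm (col j (B *m map_mx intr X)) <= tau) ->
  successive_minimum B l <= tau.
Proof.
move=> fB ln fX leX; apply: (successive_minimum_attained fB ln).2.
exists (B *m map_mx intr X); split => // [|j].
  by rewrite /cols_free trmx_mul /row_free mxrankMfree.
by exists (col j X) => //; exact: col_lattice_vector.
Qed.

Lemma successive_minimum_ge0 (R : realType) m n l (B : 'M[R]_(m, n)) :
  cols_free B -> (1 <= l <= n)%N -> 0 <= successive_minimum B l.
Proof.
move=> fB ln; have [[V [_ _ /(_ _) leV]] _] := successive_minimum_attained fB ln.
have l0 : (0 < l)%N by case/andP: ln.
by apply: le_trans (leV (Ordinal l0)); exact: sqrtr_ge0.
Qed.

(** Any l independent lattice vectors of norm at most tau bound the l-th
    successive minimum, hence the first l columns of the reduced basis.  The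
    absolute value of c keeps the bound monotone in tau for every sign of c. *)
Lemma reduced_column_le (R : realType) n m l (c tau : R)
    (br : forall m : nat, 'M[R]_(m, n) -> 'M[int]_n) (B : 'M[R]_(m, n))
    (X : 'M[int]_(n, l)) (j : 'I_n) :
  basis_reduction_of_strength c br -> (n <= m)%N -> cols_free B ->
  (1 <= l <= n)%N -> row_free (map_mx intr X : 'M[R]_(n, l))^T ->
  (forall k, enorm (col k (B *m map_mx intr X)) <= tau) -> (j < l)%N ->
  enorm (B *m map_mx intr (col j (br m B))) <= `|c| * tau.
Proof.
move=> red nm fB ln fX leX jl; rewrite col_lattice_vector.
have [_ /(_ l ln) redl] := red m B nm fB.
apply: (@le_trans _ _ (c * successive_minimum B l)).
  apply: le_trans redl; rewrite (bigD1 j) //= le_max.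
  by rewrite lexx.
apply: le_trans (ler_norm _) _; rewrite normrM ler_wpM2l //.
by rewrite ger0_norm ?successive_minimum_ge0 // (successive_minimum_le fB ln fX).
Qed.

(** * The knapsack matrix *)

Lemma knapsack_cols_free (R : realType) t n (P : 'M[int]_(t, n))
    (r : 'rV[int]_n) (M : t.-tuple R) : cols_free (knapsack_matrix P r M).
Proof.
apply/row_freeP; exists (col_mx 0 1%:M).
by rewrite tr_col_mx trmx1 mul_row_col mulmx0 add0r mulmx1.
Qed.

Lemma knapsack_mulmx (R : realType) t n k (P : 'M[int]_(t, n))
    (r : 'rV[int]_n) (M : t.-tuple R) (X : 'M[int]_(n, k)) :
  knapsack_matrix P r M *m map_mx intr X =
  col_mx (\sum_i tnth M i *: map_mx intr (row i (P *m X)) + map_mx intr (r *m X))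
         (map_mx intr X).
Proof.
rewrite mul_col_mx mul1mx mulmxDl -map_mxM mulmx_suml; congr (col_mx (_ + _) _).
by apply: eq_bigr => i _; rewrite -scalemxAl -map_mxM row_mul.
Qed.

(** On the kernel of P the multipliers disappear from the first entry: this
    bound is uniform in M. *)
Lemma knapsack_kernel_le (R : realType) t n l (P : 'M[int]_(t, n))
    (r : 'rV[int]_n) (M : t.-tuple R) (X : 'M[int]_(n, l)) (b : int) :
  P *m X = 0 -> (forall j, mxl1 (col j X) <= b) ->
  forall j, enorm (col j (knapsack_matrix P r M *m map_mx intr X))
    <= ((mxl1 r + 1) * b)%:~R.
Proof.
move=> PX leX j; rewrite -col_lattice_vector knapsack_mulmx.
have -> : P *m col j X = 0 by rewrite colE mulmxA PX mul0mx.
rewrite big1 ?add0r => [|i _]; last by rewrite linear0 map_mx0 scaler0.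
apply: le_trans (enorm_le_mxl1 _) _.
rewrite mxl1_col_mx !mxl1_map_intr -intrD ler_int mulrDl mul1r lerD //.
apply: le_trans (mxl1M _ _) _; rewrite ler_wpM2l ?mxl1_ge0 //.
Qed.

Lemma sum_drop_tuple (V : nmodType) (T : Type) t (s : t.-tuple T) m (F : T -> V) :
  \sum_(x <- drop m s) F x = \sum_(k < t | (m <= k)%N) F (tnth s k).
Proof.
case: t s => [|t] s; first by rewrite tuple0 big_ord0 big_nil.
pose x0 := tnth s ord0.
transitivity (\sum_(m <= k < t.+1) F (nth x0 s k)).
  rewrite (big_nth x0) size_drop size_tuple -[m in RHS]add0n big_addn.
  by apply: eq_bigr => k _; rewrite nth_drop addnC.
by rewrite big_geq_mkord; apply: eq_bigr => k _; rewrite (tnth_nth x0).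
Qed.

(** The first entry of A u is at most K in absolute value, and so is every
    entry of u.  In that first entry the terms before i vanish by assumption
    and those after i, together with r u, are at most
    K (mxl1 P * sum of the later multipliers + mxl1 r).  A nonzero integer
    p_i u would contribute at least M_i, too much to be compensated. *)
Lemma knapsack_coord_eq0 (R : realType) t n (P : 'M[int]_(t, n))
    (r : 'rV[int]_n) (M : t.-tuple R) (u : 'cV[int]_n) (K : R) (i : 'I_t) :
  enorm (knapsack_matrix P r M *m map_mx intr u) <= K ->
  (forall k : 'I_t, (k < i)%N -> (P *m u) k 0 = 0) ->
  K * (1 + (mxl1 r)%:~R
         + (mxl1 P)%:~R * \sum_(k < t | (i < k)%N) `|tnth M k|) < tnth M i ->
  (P *m u) i 0 = 0.
Proof.
move=> leK Pu0 ltM.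
have K0 : 0 <= K by apply: le_trans leK; exact: sqrtr_ge0.
have eK h : `|(knapsack_matrix P r M *m map_mx intr u) h 0| <= K.
  by apply: le_trans leK; exact: entry_le_enorm.
rewrite knapsack_mulmx in eK.
have uK j : `|(u j 0)%:~R : R| <= K.
  by have := eK (rshift 1 j); rewrite col_mxEd mxE.
have imK m (A : 'M[int]_(m, n)) h : `|((A *m u) h 0)%:~R : R| <= K * (mxl1 A)%:~R.
  rewrite mxE rmorph_sum; apply: le_trans (ler_norm_sum _ _ _) _ => /=.
  apply: (@le_trans _ _ (\sum_j K * (`|A h j|)%:~R)).
    by apply: ler_sum => j _; rewrite rmorphM normrM mulrC intr_norm ler_wpM2r ?uK.
  by rewrite -mulr_sumr ler_wpM2l // -rmorph_sum ler_int row_le_mxl1.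
apply/eqP/negPn/negP => Pui.
have Pui1 : 1 <= `|((P *m u) i 0)%:~R : R|.
  by rewrite -intr_norm -[1]/(1%:~R) ler_int -gtz0_ge1 normr_gt0.
have M0 : 0 < tnth M i.
  apply: le_lt_trans ltM; rewrite mulr_ge0 // !addr_ge0 ?mulr_ge0 ?ler0z ?mxl1_ge0 //.
  exact: sumr_ge0.
have := eK (lshift n 0); rewrite col_mxEu mxE [X in `|_ + X|]mxE summxE.
rewrite (bigD1 i) //= (bigID (fun k : 'I_t => (k < i)%N)) /= big1 ?add0r; last first.
  by move=> k /andP[_ ki]; rewrite mxE [map_mx _ _ _ _]mxE [row _ _ _ _]mxE Pu0 ?mulr0.
rewrite mxE [map_mx _ _ _ _]mxE [row _ _ _ _]mxE.
set p := _%:~R; set T := \sum_(k < t | _) _; set z := _%:~R => le1.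
have leT : `|T| <= K * ((mxl1 P)%:~R * \sum_(k < t | (i < k)%N) `|tnth M k|).
  rewrite mulrA mulr_sumr; apply: le_trans (ler_norm_sum _ _ _) _.
  rewrite [leRHS](eq_bigl (fun k : 'I_t => (k != i) && ~~ (k < i)%N)); last first.
    by move=> k; rewrite -leqNgt ltn_neqAle eq_sym.
  apply: ler_sum => k _; rewrite mxE [map_mx _ _ _ _]mxE [row _ _ _ _]mxE.
  by rewrite normrM mulrC ler_wpM2r ?imK.
have lez : `|z| <= K * (mxl1 r)%:~R by exact: imK.
have : tnth M i <= `|tnth M i * p|.
  by rewrite normrM (gtr0_norm M0) ler_peMr // ltW.
apply/negP; rewrite -ltNge; apply: le_lt_trans ltM.
rewrite !mulrDr mulr1; apply: le_trans (lerD (lerD le1 lez) leT).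
(* tnth M i * p is the whole first entry minus z minus T *)
rewrite -{1}[tnth M i * p](addrK T) -{1}[_ * p + T](addrK z).
by apply: le_trans (ler_normB _ _) _; rewrite lerD2r ler_normB.
Qed.

(** * Thresholds of polynomial size *)

(** The exponent E, for size_mx P = a, size_mx r = b and size_rat c = c.  The
    summands are the exponents of the factors of the threshold: c for the
    strength, b.+1 for mxl1 r + 1, a * (2 * a + 5) for the kernel vectors, and
    a + b for replacing 1 + mxl1 r + mxl1 P * x by a multiple of 1 + x. *)
Definition threshold_exp (a b c : nat) : nat := 
  (c + (b.+1 + a * (2 * a + 5)) + (a + b))%N.

(** The left-hand side is the bound of [short_kernel_vectors] for b = h. *)
Lemma kernel_bound_le (F : realDomainType) (h : F) (a t n : nat) :
  2 <= h -> (t <= a)%N -> t%:R <= h -> n%:R <= h ->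
  h ^+ (2 * t) *+ n + h ^+ 2 * (h ^+ (2 * t) *+ (t * t)) <= h ^+ (2 * a + 5).
Proof.
move=> h2 ta th nh.
have h1 : 1 <= h by apply: le_trans h2; rewrite ler1n.
have h0 : 0 <= h by exact: le_trans h1.
have le2 : h ^+ (2 * t) <= h ^+ (2 * a) by rewrite ler_weXn2l // leq_mul2l.
rewrite (exprD h (2 * a)).
have : 0 <= h ^+ (2 * t) by exact: exprn_ge0.
have : 0 <= h ^+ (2 * a) by exact: exprn_ge0.
move: (h ^+ (2 * t)) (h ^+ (2 * a)) le2 => x y xy y0 x0.
rewrite -mulr_natr -[x *+ (t * t)]mulr_natr natrM.
apply: (@le_trans _ _ (y * (h + h ^+ 2 * (h * h)))).
  rewrite mulrDr; apply: lerD; first exact: ler_pM.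
  rewrite [leRHS]mulrCA; apply: ler_wpM2l; first exact: sqr_ge0.
  by apply: ler_pM; rewrite ?mulr_ge0 //; apply: ler_pM.
rewrite ler_wpM2l // -expr2 -exprD; apply: (@le_trans _ _ (2 * h ^+ 4)).
  by rewrite mulr_natl mulr2n lerD2r -[leLHS]expr1 ler_weXn2l.
by rewrite [leRHS]exprS ler_wpM2r // exprn_ge0.
Qed.

(** The left-hand side is the quantity that M_i has to exceed in
    [knapsack_coord_eq0]: g * ((r + 1) * b1) is the norm bound K, with g the
    absolute strength, p and r the l1 norms of P and of the vector r, b1 the
    bound on the kernel vectors, and x the sum of the later multipliers. *)
Lemma threshold_suffices (R : realFieldType) (a b c : nat) (g p r x b1 : R) :
  (0 < a)%N ->
  0 <= g <= 2 ^+ c -> 0 <= p <= 2 ^+ a -> 0 <= r <= 2 ^+ b ->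
  0 <= b1 <= 2 ^+ (a * (2 * a + 5)) -> 0 <= x ->
  g * ((r + 1) * b1) * (1 + r + p * x) <= 2 ^+ threshold_exp a b c * (1 + x).
Proof.
move=> a0 /andP[g0 gc] /andP[p0 pa] /andP[r0 rb] /andP[b10 b1a] x0.
have two1 k : 1 <= 2 ^+ k :> R by rewrite exprn_ege1 // ler1n.
have rb1 : r + 1 <= 2 ^+ b.+1.
  by rewrite exprS; have := two1 b; lra.
rewrite /threshold_exp (exprD _ (c + _)%N (a + b)%N) -[leRHS]mulrA.
 apply: ler_pM.
- by rewrite !mulr_ge0 // addr_ge0.
- by rewrite !addr_ge0 // mulr_ge0.
- rewrite exprD; apply: ler_pM => //; first by rewrite mulr_ge0 // addr_ge0.
  by rewrite exprD; apply: ler_pM => //; rewrite addr_ge0.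
have a2 : 2 <= 2 ^+ a :> R by rewrite -[leLHS]expr1 ler_weXn2l // ler1n.
rewrite exprD mulrDr mulr1; apply: lerD.
  by have := two1 b; nra.
by rewrite ler_wpM2r // (le_trans pa) // ler_peMr // exprn_ge0.
Qed.

(** With base 2 y, the geometric sum up to (2 y) ^ m stays below
    (2 y) ^ (m + 1) / y because the ratio leaves a spare factor 2. *)
Lemma geometric_tail_lt (F : realDomainType) (y : F) (t i : nat) :
  1 <= y -> (i < t)%N ->
  y * (1 + \sum_(i.+1 <= k < t) (2 * y) ^+ (t - k)) < (2 * y) ^+ (t - i).
Proof.
move=> y1; move: {-1}(t - i.+1)%N (erefl (t - i.+1)%N) => d.
elim: d i => [|d IH] i di it.
  have -> : t = i.+1 by lia.
  by rewrite big_geq // subSnn addr0 mulr1 expr1; lra.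
have it1 : (i.+1 < t)%N by lia.
rewrite big_ltn // (_ : t - i = (t - i.+1).+1)%N; last by lia.
rewrite exprS; have := IH i.+1 ltac:(lia) it1.
set s := \sum_(_ <= _ < _) _; set z := _ ^+ _ => h.
have z0 : 0 < z by rewrite exprn_gt0 //; lra.
by nra.
Qed.

Lemma size_int_exp2_le (a : nat) : (size_int (2 ^+ a) <= a.+2)%N.
Proof.
rewrite /size_int add1n ltnS; apply: up_log_min => //.
by rewrite abszX expnS mul2n -addnn -addn1 leq_add2l expn_gt0.
Qed.

(** The bit length of the geometric multipliers, as an honest polynomial in the
    three sizes. *)
Lemma size_poly_exists : exists q : mpoly.mpoly 3 int, forall a b c : nat,
  mpoly.meval (tnth [tuple a%:Z; b%:Z; c%:Z]) q
    = ((threshold_exp a b c).+1 * a + 2)%N%:Z.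
Proof.
pose X k := mpoly.mpolyX int (mpoly.mnm1 k) : mpoly.mpoly 3 int.
pose x := X (inord 0); pose y := X (inord 1); pose z := X (inord 2).
exists ((z + (y + 1 + x * (x *+ 2 + 1 *+ 5)) + (x + y) + 1) * x + 1 *+ 2) => a b c.
rewrite !(mpoly.mevalD, mpoly.mevalM, mpoly.mevalMn, mpoly.meval1) !mpoly.mevalXU.
rewrite !(tnth_nth 0) !inordK //= /threshold_exp; lia.
Qed.

Theorem theorem4p1 (R : realType) :
  exists (f : forall t n : nat, 'I_t ->
                seq R -> nat -> 'M[int]_(t, n) -> 'rV[int]_n -> rat -> R)
         (q : mpoly.mpoly 3 int),
  forall (t n : nat) (P : 'M[int]_(t, n)) (r : 'rV[int]_n) (c : rat)
         (br : forall m : nat, 'M[R]_(m, n) -> 'M[int]_n),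
    (2 <= t)%N ->
    row_free (map_mx intr P : 'M[R]_(t, n)) ->
    (forall i j, 0 < P i j) ->
    basis_reduction_of_strength (ratr c) br ->
  forall s : t.-tuple nat,
    (forall i : 'I_t, (1 <= tnth s i <= n - t)%N) ->
    (forall i k : 'I_t, (i <= k)%N -> (tnth s k <= tnth s i)%N) ->
    (forall M : t.-tuple R,
       (forall i k : 'I_t, (i < k)%N -> tnth M k < tnth M i) ->
       (forall i : 'I_t, f t n i (drop i.+1 M) (tnth s i) P r c < tnth M i) ->
       let U := br (1 + n)%N (knapsack_matrix P r M) in
       forall (i : 'I_t) (j : 'I_n), (j < tnth s i)%N -> (P *m U) i j = 0)
    /\
    (exists M : t.-tuple int,
       [/\ forall i k : 'I_t, (i < k)%N -> tnth M k < tnth M i,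
           forall i : 'I_t,
             f t n i (drop i.+1 (map intr M)) (tnth s i) P r c
               < (tnth M i)%:~R &
           forall i : 'I_t,
             (size_int (tnth M i))%:Z <=
               mpoly.meval
                 (tnth [tuple (size_mx P)%:Z; (size_mx r)%:Z; (size_rat c)%:Z])
                 q]).
Proof.
have [q qE] := size_poly_exists.
exists (fun t n i tail s P r c =>
  2 ^+ threshold_exp (size_mx P) (size_mx r) (size_rat c)
    * (1 + \sum_(x <- tail) `|x|)), q.
move=> t n P r c br t2 fP _ red s s_bd s_mono.
have t0 : (0 < t)%N by exact: ltnW.
have nt : (t < n)%N by have /andP[/leq_trans h /h] := s_bd (Ordinal t0); rewrite subn_gt0.
have tna : (t * n <= size_mx P)%N by exact: leq_addr.
have ta : (t <= size_mx P)%N by apply: leq_trans tna; rewrite leq_pmulr // (leq_trans _ nt).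
have na : (n <= size_mx P)%N by apply: leq_trans tna; rewrite leq_pmull.
have a0 : (0 < size_mx P)%N by exact: leq_trans t0 ta.
have intr_exp2 (z : int) k : z <= 2 ^+ k -> z%:~R <= 2 ^+ k :> R.
  by rewrite -(ler_int R) rmorphXn.
split.
- move=> M _ Mgt U i.
  pose b2 : int := (2 ^+ size_mx P) ^+ (2 * t) *+ n
    + (2 ^+ size_mx P) ^+ 2 * ((2 ^+ size_mx P) ^+ (2 * t) *+ (t * t)).
  have b2_ge0 : 0 <= b2 by rewrite addr_ge0 ?mulr_ge0 ?mulrn_wge0 ?exprn_ge0.
  have le_h k : (k <= size_mx P)%N -> k%:R <= 2 ^+ size_mx P :> int.
    by move=> ka; rewrite -natrX ler_nat (leq_trans ka) // ltnW // ltn_expl.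
  have b2_le : b2 <= 2 ^+ (size_mx P * (2 * size_mx P + 5)).
    rewrite exprM; apply: kernel_bound_le => //; [|exact: le_h..].
    by rewrite -[leLHS]expr1 ler_weXn2l.
  (* induct on i for a fixed column j: s_mono carries j to the earlier rows *)
  have [m] := ubnP (val i); elim: m i => // m IH i /ltnSE im j ji.
  have [s1 sn] := andP (s_bd i).
  have s1n : (1 <= tnth s i <= n)%N by rewrite s1 (leq_trans sn) ?leq_subr.
  have h1 : 1 <= 2 ^+ size_mx P :> int by exact: exprn_ege1.
  have [X [PX fX leX]] := short_kernel_vectors fP h1 (mxl1_exp2 P) sn.
  have shortu := reduced_column_le red (leq_addl 1 n) (knapsack_cols_free P r M)
    s1n fX (knapsack_kernel_le r M PX leX) ji.
  have colU k : (P *m col j U) k 0 = (P *m U) k j.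
    by rewrite colE mulmxA -colE mxE.
  rewrite -colU; apply: (knapsack_coord_eq0 shortu) => [k ki|].
    rewrite colU; apply: IH; first exact: leq_trans ki im.
    by apply: leq_trans ji _; exact: s_mono (ltnW ki).
  apply: le_lt_trans (Mgt i); rewrite sum_drop_tuple -/b2.
  rewrite intrM intrD; apply: threshold_suffices => //.
  + by rewrite normr_ge0 ratr_exp2.
  + by rewrite ler0z mxl1_ge0 intr_exp2 // mxl1_exp2.
  + by rewrite ler0z mxl1_ge0 intr_exp2 // mxl1_exp2.
  + by rewrite ler0z b2_ge0 intr_exp2.
  + exact: sumr_ge0.
(* the indices start at 0, so the last multiplier is 2 ^ e, not 1 *)
pose e := (threshold_exp (size_mx P) (size_mx r) (size_rat c)).+1.
exists [tuple 2 ^+ (e * (t - k)) | k < t]; split.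
- move=> i k ik; rewrite !tnth_mktuple ltr_eXn2l // ltn_pmul2l //.
  by rewrite ltn_sub2l // (leq_trans _ (ltn_ord k)).
- move=> i; rewrite tnth_mktuple -map_drop big_map sum_drop_tuple.
  pose y : R := 2 ^+ threshold_exp (size_mx P) (size_mx r) (size_rat c).
  have ye k : (2 ^+ (e * k) : int)%:~R = (2 * y) ^+ k.
    by rewrite rmorphXn exprM /= exprS.
  have y0 k : 0 <= (2 * y) ^+ k by rewrite exprn_ge0 // mulr_ge0 // exprn_ge0.
  rewrite ye; under eq_bigr => k _ do rewrite tnth_mktuple ye (ger0_norm (y0 _)).
  rewrite -(big_geq_mkord _ _ predT (fun k => (2 * y) ^+ (t - k))).
  by apply: geometric_tail_lt => //; rewrite exprn_ege1 // ler1n.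
- move=> i; rewrite tnth_mktuple qE lez_nat.
  apply: leq_trans (size_int_exp2_le _) _; rewrite addn2 !ltnS leq_mul2l.
  by rewrite (leq_trans (leq_subr _ _) ta) orbT.
Qed.
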